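(* Let $\mathsf{k}$ be a commutative ring, $A$ a countable set, $\diamond$ a commutative associative $\mathsf{k}$-bilinear product on $\mathsf{k}A$, and $a\in A$. Let $\{a\}^{\lambda/\mu}\in\mathcal{Y}_\diamond$ be a constant-entry tableau of shape $\lambda/\mu$ with $n=|\lambda|-|\mu|$. Assume that $n!$ is invertible in $\mathsf{k}$. Then $$\{a\}^{\lambda/\mu}\in\mathbb{Z}[\tfrac1{n!}]\bigl[\{a^{\diamond l}\}^{(1)}\mid l\ge1\bigr],$$ the subalgebra of $\mathcal{Y}_\diamond$ generated over $\mathbb{Z}[\tfrac1{n!}]$ by the depth-one tableaux $\{a^{\diamond l}\}^{(1)}$ under $\ast$. In particular, if $\mathbb{Q}\subseteq\mathsf{k}$, then $\{a\}^{\lambda/\mu}\in\mathbb{Q}[\{a^{\diamond l}\}^{(1)}\mid l\ge1]$.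
   Context: $\mathsf{k}A$ is the free $\mathsf{k}$-module with basis $A$; $a^{\diamond l}=a\diamond\cdots\diamond a$ ($l$ factors). $\mathsf{k}\langle A\rangle$ is the free associative $\mathsf{k}$-algebra on $A$ with basis the words. Tableaux. For partitions $\mu\subseteq\lambda$ (padded by zeros), $D(\lambda/\mu)=\{(i,j):\mu_i<j\le\lambda_i\}$ ($i$ row index increasing downwards, $j$ column index). A Young tableau of shape $\mathrm{sh}(\mathbf h)=\lambda/\mu$ with entries in $A$ is any family $\mathbf h=(h_{i,j})_{(i,j)\in D(\lambda/\mu)}$; $\mathrm{YT}(A)$ is the set of all of them; $\mathbf 1$ is the empty tableau; $\{a\}^{\lambda/\mu}$ is the tableau of shape $\lambda/\mu$ with all entries $a$ (and its class). For $\mathbf h$ of shape $\lambda/\mu$, $\lambda=(\lambda_1,\dots,\lambda_r)$, cut $\mathbf h$ after every row $i$ with $\mu_i\ge\lambda_{i+1}$ ($\lambda_{r+1}:=0$); translate each resulting piece up and to the left so that it starts in row $1$ and as far left as possible (a piece without boxes becomes $\mathbf 1$). The resulting multiset is $\mathrm{SC}(\mathbf h)$. $\mathcal{Y}$ (written $\mathsf{k}\boxed{A}$ in the paper) is the commutative algebra $\mathsf{k}[\mathrm{YT}(A)]$ modulo the relations $\mathbf h=\prod_{\mathbf i\in\mathrm{SC}(\mathbf h)}\mathbf i$, with $\mathbf 1$ the unit; its product is $\ast$. Tableaux may have entries in $\mathsf{k}A$, extended $\mathsf{k}$-linearly in each entry, so $\{a^{\diamond l}\}^{(1)}$ is the one-box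 tableau with entry $a^{\diamond l}$. Linearization. A skew shape is a horizontal strip if no column contains two boxes. $\mathrm{SSD}(\lambda/\mu)$ is the set of tuples $(D_1,\dots,D_r)$, $D_t=D(\eta^{(t)}/\eta^{(t-1)})$, coming from chains of partitions $\mu=\eta^{(0)}\subsetneq\cdots\subsetneq\eta^{(r)}=\lambda$ with every $\eta^{(t)}/\eta^{(t-1)}$ a horizontal strip. $L_\diamond:\mathcal{Y}\to\mathsf{k}\langle A\rangle$ is the $\mathsf{k}$-linear map $L_\diamond(\mathbf h)=\sum_{(D_1,\dots,D_r)\in\mathrm{SSD}(\mathrm{sh}(\mathbf h))}|\mathbf h_{D_1}|_\diamond\cdots|\mathbf h_{D_r}|_\diamond$ (concatenation), $|\mathbf h_D|_\diamond\in\mathsf{k}A$ being the $\diamond$-product of all $h_{i,j}$, $(i,j)\in D$, and $L_\diamond(\mathbf 1)=\mathbf 1$. It is an algebra homomorphism to $\mathsf{k}\langle A\rangle$ with the quasi-shuffle product associated with $\diamond$, and $\mathcal{Y}_\diamond:=\mathcal{Y}/\ker(L_\diamond)$ with induced product $\ast$. *)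

(* Defs.v *)
From HB Require Import structures.
From mathcomp Require Import all_boot all_order all_algebra.
From mathcomp Require Import generic_quotient ring_quotient.
From mathcomp Require Import finmap boolp.
From mathcomp.multinomials Require Import monalg.

Set Implicit Arguments.
Unset Strict Implicit.
Unset Printing Implicit Defensive.

Import GRing.Theory.

Local Open Scope ring_scope.
Local Open Scope quotient_scope.

(** The ring quotient of ring_quotient.v is only available for proper ideals;
    here the quotient by the ideal generated by [G] may be the zero ring, so
    that no properness proof is needed. *)

Section GeneratedIdeal.
Variables (R : comPzRingType) (G : R -> Prop).

Inductive ideal_gen : R -> Prop :=
| ideal_gen_in x : G x -> ideal_gen x
| ideal_gen_0 : ideal_gen 0
| ideal_gen_add x y : ideal_gen x -> ideal_gen y -> ideal_gen (x + y)
| ideal_gen_mul x y : ideal_gen y -> ideal_gen (x * y).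

Definition ideal_pred : {pred R} := fun x => `[< ideal_gen x >].

Lemma ideal_predP x : reflect (ideal_gen x) (x \in ideal_pred).
Proof. exact: asboolP. Qed.

Fact ideal_pred_zmod_closed : zmod_closed ideal_pred.
Proof.
split=> [|x y /ideal_predP hx /ideal_predP hy]; apply/ideal_predP.
  exact: ideal_gen_0.
by apply: ideal_gen_add => //; rewrite -mulN1r; apply: ideal_gen_mul.
Qed.
HB.instance Definition _ :=
  GRing.isZmodClosed.Build R ideal_pred ideal_pred_zmod_closed.

Lemma ideal_predM x y : y \in ideal_pred -> x * y \in ideal_pred.
Proof. by move=> /ideal_predP hy; apply/ideal_predP/ideal_gen_mul. Qed.

Definition ring_quot : Type := Quotient.quot (ideal_pred : zmodClosed R).
HB.instance Definition _ := GRing.Zmodule.on ring_quot.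

Definition rq_pi (x : R) : ring_quot := \pi_(Quotient.quot (ideal_pred : zmodClosed R)) x.

Lemma rq_piP x y : rq_pi x = rq_pi y <-> ideal_gen (x - y).
Proof.
split=> [/eqP|h]; first by rewrite -Quotient.idealrBE => /ideal_predP.
by apply/eqP; rewrite -Quotient.idealrBE; apply/ideal_predP.
Qed.

Lemma rq_reprK (q : ring_quot) : rq_pi (repr q) = q.
Proof. exact: reprK. Qed.

Fact rq_pi_is_zmod_morphism : zmod_morphism rq_pi.
Proof. by move=> x y; rewrite /rq_pi !piE. Qed.
HB.instance Definition _ :=
  GRing.isZmodMorphism.Build R ring_quot rq_pi rq_pi_is_zmod_morphism.

Definition rq_one : ring_quot := rq_pi 1.
Definition rq_mul (p q : ring_quot) : ring_quot := rq_pi (repr p * repr q).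

Lemma rq_piM x y : rq_pi (x * y) = rq_mul (rq_pi x) (rq_pi y).
Proof.
have hr z : ideal_gen (z - repr (rq_pi z)) by apply/rq_piP; rewrite rq_reprK.
apply/rq_piP; set x' := repr _; set y' := repr _.
have -> : x * y - x' * y' = y * (x - x') + x' * (y - y').
  by rewrite !mulrBr [y * x]mulrC [y * x']mulrC addrA subrK.
by apply: ideal_gen_add; apply: ideal_gen_mul; apply: hr.
Qed.

Fact rq_mulA : associative rq_mul.
Proof.
move=> p q r; rewrite -[p]rq_reprK -[q]rq_reprK -[r]rq_reprK.
by rewrite -!rq_piM mulrA.
Qed.

Fact rq_mulC : commutative rq_mul.
Proof.
by move=> p q; rewrite -[p]rq_reprK -[q]rq_reprK -!rq_piM mulrC.
Qed.

Fact rq_mul1 : left_id rq_one rq_mul.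
Proof. by move=> p; rewrite -[p]rq_reprK -rq_piM mul1r. Qed.

Fact rq_mulD : left_distributive rq_mul +%R.
Proof.
move=> p q r; rewrite -[p]rq_reprK -[q]rq_reprK -[r]rq_reprK.
by rewrite -raddfD -!rq_piM mulrDl raddfD.
Qed.

HB.instance Definition _ := GRing.Zmodule_isComPzRing.Build ring_quot
  rq_mulA rq_mulC rq_mul1 rq_mulD.

Fact rq_pi_is_monoid_morphism : monoid_morphism rq_pi.
Proof. by split=> // x y; rewrite rq_piM. Qed.
HB.instance Definition _ :=
  GRing.isMonoidMorphism.Build R ring_quot rq_pi rq_pi_is_monoid_morphism.

End GeneratedIdeal.

(** Subalgebra of a commutative [k]-algebra [Q], given by its structure map
    [scal], generated by [G] over the subring [C] of [k]. *)
Inductive subalg_gen (k Q : comPzRingType) (scal : {rmorphism k -> Q})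
    (C : k -> Prop) (G : Q -> Prop) : Q -> Prop :=
| subalg_gen_scal c : C c -> subalg_gen scal C G (scal c)
| subalg_gen_in x : G x -> subalg_gen scal C G x
| subalg_gen_add x y : subalg_gen scal C G x -> subalg_gen scal C G y ->
    subalg_gen scal C G (x + y)
| subalg_gen_mul x y : subalg_gen scal C G x -> subalg_gen scal C G y ->
    subalg_gen scal C G (x * y).

(** Boxes are indexed from 0: the box (i, j) of the text is (i - 1, j - 1)
    here, so that [D(lam/mu)] consists of the (i, j) with
    [mu_i <= j < lam_i]. *)

Definition is_partition (s : seq nat) : bool := sorted geq s && (0%N \notin s).

Definition included (mu lam : seq nat) : bool :=
  (size mu <= size lam)%N &&
  all (fun i => (nth 0 mu i <= nth 0 lam i)%N) (iota 0 (size lam)).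

Definition skew_shape (lam mu : seq nat) : bool :=
  [&& is_partition lam, is_partition mu & included mu lam].

Definition diagram (lam mu : seq nat) : seq (nat * nat) :=
  [seq (i, j) | i <- iota 0 (size lam),
                j <- iota (nth 0 mu i) (nth 0 lam i - nth 0 mu i)].

(** [lam/mu] is a nonempty horizontal strip; [lam] and [mu] may be padded by
    zeros. *)
Definition hstrip (mu lam : seq nat) : bool :=
  [&& sorted geq lam, included mu lam, mu != lam
    & uniq [seq b.2 | b <- diagram lam mu]].

Section Tableaux.
Variable A : choiceType.

(** A tableau [h] of shape [lam/mu] is stored as the list of its rows, the row
    of index [i] being the pair of [mu_i] and of the word
    [h_(i, mu_i) ... h_(i, lam_i - 1)]. *)
Definition inner (h : seq (nat * seq A)) : seq nat := [seq r.1 | r <- h].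
Definition outer (h : seq (nat * seq A)) : seq nat :=
  [seq (r.1 + size r.2)%N | r <- h].

Definition is_tableau (h : seq (nat * seq A)) : bool :=
  sorted geq (inner h) && is_partition (outer h).

Record YT : predArgType :=
  MkYT { rows :> seq (nat * seq A); rowsP : is_tableau rows }.
HB.instance Definition _ := [isSub for rows].
HB.instance Definition _ := [Choice of YT by <:].

Definition entry (h : seq (nat * seq A)) (b : nat * nat) : option A :=
  let r := nth (0%N, [::]) h b.1 in onth r.2 (b.2 - r.1).

Definition tabulate (lam mu : seq nat) (a : A) : seq (nat * seq A) :=
  mkseq (fun i => (nth 0%N mu i, nseq (nth 0 lam i - nth 0 mu i) a))
        (size lam).

Lemma nth_sorted_geq s : sorted geq s ->
  forall i j, (i <= j)%N -> (nth 0 s j <= nth 0 s i)%N.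
Proof.
move=> hs i j ij; case: (ltnP j (size s)) => hj; last by rewrite nth_default.
by apply: (sorted_leq_nth (rev_trans leq_trans) leqnn) => //;
  rewrite inE (leq_ltn_trans ij).
Qed.

Lemma inner_tabulate lam mu a :
  inner (tabulate lam mu a) = mkseq (nth 0 mu) (size lam).
Proof. by rewrite /inner -map_comp. Qed.

Lemma outer_tabulate lam mu a : included mu lam ->
  outer (tabulate lam mu a) = lam.
Proof.
case/andP=> _ /allP h; rewrite /outer -map_comp -[RHS](mkseq_nth 0).
apply/eq_in_map => i hi /=; rewrite size_nseq subnKC //; exact: h.
Qed.

Fact tabulateP lam mu a : skew_shape lam mu -> is_tableau (tabulate lam mu a).
Proof.
case/and3P=> hlam /andP[hmu _] hle; rewrite /is_tableau outer_tabulate //.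
rewrite hlam andbT inner_tabulate; apply/(sortedP 0%N) => i.
rewrite size_mkseq => hi; rewrite !nth_mkseq // 1?ltnW //.
exact: nth_sorted_geq.
Qed.

(** The tableau [{a}^(lam/mu)]. *)
Definition const_tab lam mu (hs : skew_shape lam mu) (a : A) : YT :=
  MkYT (tabulateP a hs).

Definition box1 (a : A) : YT := @const_tab [:: 1%N] [::] isT a.

(** Cut after every row [i] with [lam_(i+1) <= mu_i]. *)
Fixpoint cut (h : seq (nat * seq A)) : seq (seq (nat * seq A)) :=
  if h is r :: h' then
    if (nth 0 (outer h') 0 <= r.1)%N then [:: r] :: cut h'
    else if cut h' is p :: ps then (r :: p) :: ps else [:: [:: r]]
  else [::].

(** A piece with at least two rows has no empty row, so the smallest [mu_i] is
    its leftmost column. *)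
Definition translate (p : seq (nat * seq A)) : seq (nat * seq A) :=
  if all (fun r => nilp r.2) p then [::]
  else [seq ((r.1 - last 0 (inner p))%N, r.2) | r <- p].

Definition SC_rows (h : seq (nat * seq A)) : seq (seq (nat * seq A)) :=
  map translate (cut h).

Lemma cut_head r h : exists p ps, cut (r :: h) = (r :: p) :: ps.
Proof.
rewrite /=; case: leqP => _; first by exists [::], (cut h).
by case: (cut h) => [|p ps]; [exists [::], [::] | exists p, ps].
Qed.

Lemma flatten_cut h : flatten (cut h) = h.
Proof.
elim: h => //= r h IH; case: leqP => _ /=; first by rewrite IH.
by case: (cut h) IH => [|p ps] /= <-.
Qed.

Definition linked (r r' : nat * seq A) := (r.1 < r'.1 + size r'.2)%N.

Lemma cut_linked h : all (sorted linked) (cut h).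
Proof.
elim: h => //= r h IH; case: leqP => //= hr.
case: h hr IH => [//|r' h] hr.
by have [p [ps ->]] := cut_head r' h => /= /andP[-> ->]; rewrite /linked hr.
Qed.

Lemma translateP p : sorted geq (inner p) -> sorted geq (outer p) ->
  sorted linked p -> is_tableau (translate p).
Proof.
rewrite /translate; case: ifP => [//|/negbT].
case/lastP: p => [//|q r] hall hin hout hlk.
have hlast : last 0%N (inner (rcons q r)) = r.1.
  by rewrite /inner map_rcons last_rcons.
have tr : transitive geq by exact: rev_trans leq_trans.
have hle x : x \in rcons q r ->
    (r.1 <= x.1)%N && (r.1 + size r.2 <= x.1 + size x.2)%N.
  rewrite mem_rcons inE => /orP[/eqP->|hx]; first by rewrite !leqnn.
  move: hin hout; rewrite /inner /outer !map_rcons.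
  rewrite -!cats1 !(sorted_pairwise tr) !pairwise_cat !allrel1r.
  by case/and3P=> /allP h1 _ _ /and3P[/allP h2 _ _]; apply/andP; split;
    [apply: h1 | apply: h2]; apply/mapP; exists x.
have hr : (0 < size r.2)%N.
  case/lastP: q hall hlk hle {hin hout hlast} => [|q x].
    by rewrite /= andbT lt0n.
  move=> _ hlk /(_ x); rewrite mem_rcons inE mem_rcons mem_head orbT.
  move=> /(_ isT) /andP[hrx _].
  have : linked x r.
    move: hlk; rewrite -!cats1 -catA sorted_cat_cons.
    by case/andP=> _ /= /andP[].
  by rewrite /linked => /(leq_ltn_trans hrx); rewrite -[X in (X < _)%N]addn0 ltn_add2l.
rewrite hlast /is_tableau /is_partition.
set p' := [seq _ | _ <- _].
have -> : inner p' = [seq (i - r.1)%N | i <- inner (rcons q r)].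
  by rewrite /inner /p' -!map_comp.
have -> : outer p' = [seq (i - r.1)%N | i <- outer (rcons q r)].
  rewrite /outer /p' -!map_comp; apply/eq_in_map => x /hle /andP[hx _] /=.
  by rewrite addnBAC.
have hs s : sorted geq s -> sorted geq [seq (i - r.1)%N | i <- s].
  by apply: homo_sorted => i j /= ji; rewrite leq_sub2r.
rewrite !hs //=; apply/negP => /mapP[_ /mapP[x /hle /andP[_ hx] ->]] /eqP.
rewrite eq_sym subn_eq0 leqNgt => /negP; apply.
by apply: leq_trans hx; rewrite -[X in (X < _)%N]addn0 ltn_add2l.
Qed.

Lemma SC_rowsP (h : YT) : all is_tableau (SC_rows h).
Proof.
apply/allP => _ /mapP[p hp ->].
have sub : subseq p h.
  rewrite -(flatten_cut h); elim: (cut h) hp => //= p' ps IH.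
  rewrite inE => /orP[/eqP<-|/IH]; first exact: prefix_subseq.
  by move/subseq_trans; apply; exact: suffix_subseq.
have tr : transitive geq by exact: rev_trans leq_trans.
case/andP: (rowsP h) => hin /andP[hout _]; apply: translateP.
- by apply: (subseq_sorted tr _ hin); apply: map_subseq.
- by apply: (subseq_sorted tr _ hout); apply: map_subseq.
- by move/allP: (cut_linked h); apply.
Qed.

(** No piece is dropped by [pmap], see [rows_SC]. *)
Definition SC (h : YT) : seq YT := pmap insub (SC_rows h).

Lemma rows_SC h : map rows (SC h) = SC_rows h.
Proof.
rewrite /SC; elim: (SC_rows h) (SC_rowsP h) => //= p ps IH /andP[hp hps].
by rewrite insubT /= IH.
Qed.

End Tableaux.

Definition lin_ext (k : comNzRingType) (B : choiceType) (V : lmodType k)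
    (f : B -> V) (x : {malg k[B]}) : V :=
  \sum_(b <- msupp x) x@_b *: f b.

Section Linearization.
Variables (k : comNzRingType) (A : choiceType).

Local Notation kA := {malg k[A]}.
Local Notation kAw := {malg k[{fmonom A}]}.
Local Notation kYT := {malg k[{cmonom YT A}]}.

Definition ptab (h : YT A) : kYT := << ucm h >>.

(** The empty tableau has no piece, so that its relation is [1 = 1_kYT]. *)
Definition SC_rel (p : kYT) : Prop :=
  exists h : YT A, p = ptab h - \prod_(i <- SC h) ptab i.

Definition Y : comPzRingType := ring_quot SC_rel.

Definition Ypi : {rmorphism kYT -> Y} := @rq_pi kYT SC_rel.

Definition letter : kA -> kAw := lin_ext (fun a => << fmu a >>).

Variable diam : kA -> kA -> kA.

(** The product of a nonempty list ([diam] has no unit). *)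
Definition dprod (s : seq kA) : kA :=
  if s is x :: s' then foldl diam x s' else 0.

Definition dpow (a : A) (l : nat) : kA := dprod (nseq l << a >>).

(** [|h_D|] for a set of boxes [D] of [h]. *)
Definition box_prod (h : YT A) (D : seq (nat * nat)) : kA :=
  dprod [seq << a >> | a <- pmap (entry h) D].

(** The elements of [SSD(lam/mu)] are encoded by their chains of partitions
    [mu = eta^(0), eta^(1), ..., eta^(r) = lam], all padded by zeros to the
    length of [lam]; a chain is stored without [eta^(0)]. *)
Definition is_SSD (lam mu : seq nat) (etas : seq (seq nat)) : bool :=
  path hstrip mu etas && (last mu etas == lam).

Definition chain_of (m N r : nat) (c : r.-tuple (m.-tuple 'I_N)) :
  seq (seq nat) := [seq map val (tval eta) | eta <- tval c].

Definition Lword (h : YT A) (etas : seq (seq nat)) : kAw :=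
  \prod_(w <- pairmap (fun eta eta' => letter (box_prod h (diagram eta' eta)))
                      (inner h) etas) w.

(** The bounds on the length of the chain and on the parts are those imposed
    by [mu <= eta^(t) <= lam] and by the strictness of the inclusions. *)
Definition Ltab (h : YT A) : kAw :=
  \sum_(r < (size (diagram (outer h) (inner h))).+1)
    \sum_(c : r.-tuple ((size (outer h)).-tuple 'I_(head 0%N (outer h)).+1)
           | is_SSD (outer h) (inner h) (chain_of c))
      Lword h (chain_of c).

(** The graph of the linear map [L_diam : Y -> k<A>] given by [Ltab] on the
    classes of tableaux, which span [Y] since every product of tableaux is
    the class of a single (disconnected) tableau. *)
Definition L_diam_graph (y : Y) (w : kAw) : Prop :=
  exists2 x : {malg k[YT A]}, y = Ypi (lin_ext ptab x) & w = lin_ext Ltab x.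

Definition kerL (y : Y) : Prop := L_diam_graph y 0.

(** [kerL] is an ideal when [diam] is bilinear, associative and commutative,
    [L_diam] being then an algebra homomorphism to the quasi-shuffle algebra:
    the ideal that it generates is [kerL] itself, and [Y_diam] is [Y/kerL]. *)
Definition Y_diam : comPzRingType := ring_quot kerL.

Definition Y_diam_pi : {rmorphism Y -> Y_diam} := @rq_pi Y kerL.

Definition Y_diam_scal : {rmorphism k -> Y_diam} :=
  Y_diam_pi \o Ypi \o (@malgC {cmonom YT A} k).

Definition tab (h : YT A) : Y_diam := Y_diam_pi (Ypi (ptab h)).

(** The one-box tableau [{x}^(1)] with entry [x] in [kA]. *)
Definition tab1 (x : kA) : Y_diam :=
  Y_diam_pi (Ypi (lin_ext (fun a => ptab (box1 a)) x)).

Definition diam_gens (a : A) (y : Y_diam) : Prop :=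
  exists2 l : nat, (1 <= l)%N & y = tab1 (dpow a l).

End Linearization.

Arguments Y_diam_scal {k A} diam.
Arguments diam_gens {k A} diam a y.

(** The image of [Z[1/N]] in [k], where [u] is the inverse of [N] in [k]. *)
Definition Z_inv (k : comNzRingType) (u c : k) : Prop :=
  exists (z : int) (m : nat), c = z%:~R * u ^+ m.

(* Main.v *)
(** The linearization of [{a}^(lam/mu)] is the skew Schur function of [lam/mu]
    with the monomial quasi-symmetric function of a composition
    [(c_1, ..., c_r)] replaced by the word [a^(<>c_1) ... a^(<>c_r)]. It is
    symmetric: given two successive horizontal strips [mu <= eta <= nu], the
    parts of [eta] range over independent intervals (Bender-Knuth), and
    reflecting all of them exchanges the sizes of the two strips. Averaging the
    words with [r] letters over the permutations of their letters thus only
    costs the denominator [r!], which divides [n!]. A symmetrized word is an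
    integral combination of quasi-shuffle products of letters [a^(<>l)], by
    Newton's recursion
    [x * M(s) = M(x :: s) + sum_i M(s with s_i replaced by x <> s_i)].
    Finally a quasi-shuffle product of letters is the linearization of a tableau
    of pairwise disconnected boxes, whose class is a product of one-box
    tableaux. *)
Require Import Defs.
From mathcomp Require Import all_boot all_order all_algebra.
From mathcomp Require Import finmap boolp zify.
From mathcomp.multinomials Require Import monalg.

Set Implicit Arguments.
Unset Strict Implicit.
Unset Printing Implicit Defensive.

Import GRing.Theory.

Local Open Scope ring_scope.

(** * Quasi-shuffles of letters and symmetrized words *)

Lemma iotaS n : iota 0 n.+1 = 0%N :: map S (iota 0 n).
Proof. by rewrite [LHS]/= -[1%N]addn0 iotaDl. Qed.

Lemma big_iotaS (V : nmodType) n (F : nat -> V) :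
  \sum_(i <- iota 0 n.+1) F i = F 0%N + \sum_(i <- iota 0 n) F i.+1.
Proof. by rewrite iotaS big_cons big_map. Qed.

Section Words.
Variables (T : Type) (op : T -> T -> T) (V : zmodType).
Implicit Types (x : T) (w s t : seq T) (f : seq T -> V) (js : seq nat).

(** [f] plays the role of a linear form on words: the prefix already read is absorbed into it, so no
    formal sum of words is ever built. *)
Fixpoint insert_new x f w : V :=
  f (x :: w) + if w is y :: w' then insert_new x (f \o cons y) w' else 0.

Fixpoint insert_merge x f w : V :=
  if w is y :: w' then f (op x y :: w') + insert_merge x (f \o cons y) w'
  else 0.

(** The quasi-shuffle product of the letter [x] with the word [w], seen through [f]: [x] takes a
    place of its own or merges with a letter of [w]. *)
Definition qinsert x f w := insert_new x f w + insert_merge x f w.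

(** The value of the linear extension of [f] at the quasi-shuffle product of
    the letters of [t]. *)
Fixpoint qshuffle t f : V :=
  if t is x :: t' then qshuffle t' (qinsert x f) else f [::].

Fixpoint swap j w :=
  match j, w with
  | 0%N, x :: y :: w' => y :: x :: w'
  | j'.+1, x :: w' => x :: swap j' w'
  | _, _ => w
  end.

Definition act js w := foldl (fun w' j => swap j w') w js.

(** Each permutation of [r] positions occurs exactly once, as a product of
    adjacent transpositions. *)
Fixpoint perms r : seq (seq nat) :=
  if r is r'.+1 then
    [seq map S js ++ iota 0 i | js <- perms r', i <- iota 0 r]
  else [:: [::]].

Definition symsum r f w := \sum_(js <- perms r) f (act js w).

Lemma size_perms r : size (perms r) = r`!.
Proof.
elim: r => // r IH.
by rewrite [LHS](size_allpairs _ (perms r)) IH size_iota factS mulnC.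
Qed.

Lemma size_swap j w : size (swap j w) = size w.
Proof. by elim: j w => [|j IH] [|x [|y w]] //=; rewrite IH. Qed.

Lemma act_cat js js' w : act (js ++ js') w = act js' (act js w).
Proof. exact: foldl_cat. Qed.

Lemma size_act js w : size (act js w) = size w.
Proof. by elim: js w => //= j js IH w; rewrite IH size_swap. Qed.

Lemma act_mapS js x w : act (map S js) (x :: w) = x :: act js w.
Proof. by elim: js w => //= j js IH w; rewrite IH. Qed.

(** The transpositions [0, ..., i - 1] carry the head [x] past the first [i] letters. *)
Lemma insert_newE x f w :
  insert_new x f w = \sum_(i <- iota 0 (size w).+1) f (act (iota 0 i) (x :: w)).
Proof.
elim: w f => [|y w IH] f; first by rewrite /= big_seq1 addr0.
rewrite [LHS]/= IH [in RHS]big_iotaS; congr (_ + _).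
by apply: eq_bigr => i _; rewrite iotaS /= act_mapS.
Qed.

(** This mirrors the construction of [perms]: permute the tail, then slide the head to any
    position. *)
Lemma symsumS r f x s : size s = r ->
  symsum r.+1 f (x :: s) = symsum r (insert_new x f) s.
Proof.
move=> <-; rewrite /symsum big_allpairs_dep; apply: eq_bigr => js _.
rewrite insert_newE size_act; apply: eq_bigr => i _.
by rewrite act_cat act_mapS.
Qed.

(** Exchanging two letters only exchanges the two terms in which one of them absorbs [x]. *)
Lemma insert_merge_swap j x f w :
  insert_merge x (f \o swap j) w = insert_merge x f (swap j w).
Proof.
elim: j w f => [|j IH] [|y w] f //=; last by rewrite -IH.
by case: w => [|z w] //=; rewrite addrCA.
Qed.

Lemma insert_merge_act js x f w :
  insert_merge x (f \o act js) w = insert_merge x f (act js w).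
Proof.
elim: js w => //= j js IH w.
by rewrite -IH -insert_merge_swap; congr insert_merge; apply/funext.
Qed.

Lemma insert_merge_sum (I : Type) (r : seq I) (F : I -> seq T -> V) x w :
  insert_merge x (fun w' => \sum_(i <- r) F i w') w =
  \sum_(i <- r) insert_merge x (F i) w.
Proof.
elim: w F => [|y w IH] F /=; first by rewrite big1.
by rewrite big_split /= -IH.
Qed.

Lemma symsum_merge r x f s :
  symsum r (insert_merge x f) s = insert_merge x (symsum r f) s.
Proof.
rewrite insert_merge_sum; apply: eq_bigr => js _.
by rewrite -insert_merge_act.
Qed.

(** Newton's identity: the product of a power sum and an (augmented) monomial
    symmetric function. *)
Lemma symsum_rec r f x s : size s = r ->
  symsum r.+1 f (x :: s) =
  symsum r (qinsert x f) s - insert_merge x (symsum r f) s.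
Proof.
by move=> sr; rewrite symsumS // -symsum_merge /symsum big_split /= addrK.
Qed.

Lemma insert_merge_closed (P : V -> Prop) x f w : P 0 ->
  (forall v v', P v -> P v' -> P (v + v')) ->
  (forall w', size w' = size w -> P (f w')) -> P (insert_merge x f w).
Proof.
move=> P0 PD; elim: w f => //= y w IH f Pf; apply: PD; first exact: Pf.
by apply: IH => w' ww'; apply: Pf; rewrite /= ww'.
Qed.

(** Induction on [r] along Newton's identity, for all [f] at once. Since [qshuffle t (qinsert x f)]
    is [qshuffle (x :: t) f], the assumption on [f] passes to [qinsert x f]; the merged terms are
    symmetrizations of words with one letter fewer. *)
Lemma symsum_closed (P : V -> Prop) f r s : P 0 ->
  (forall v v', P v -> P v' -> P (v + v')) ->
  (forall v, P v -> P (- v)) ->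
  size s = r -> (forall t, P (qshuffle t f)) -> P (symsum r f s).
Proof.
move=> P0 PD PN; elim: r s f => [|r IH] [|x s] f //= sr Pf.
  by rewrite /symsum big_seq1; apply: (Pf [::]).
case: sr => sr; rewrite symsum_rec //; apply: (PD).
  by apply: IH => // t; apply: (Pf (_ :: _)).
apply: PN; apply: (@insert_merge_closed P) => // w' ws.
by apply: IH => //; apply: etrans sr.
Qed.

End Words.

Section WordMorphism.
Variables (T T' : Type) (op : T -> T -> T) (op' : T' -> T' -> T').
Variables (h : T -> T') (hM : forall x y, h (op x y) = op' (h x) (h y)).
Variable V : zmodType.
Implicit Type f : seq T' -> V.

Lemma insert_new_map x f w :
  insert_new (h x) f (map h w) = insert_new x (f \o map h) w.
Proof. by elim: w f => //= y w IH f; rewrite IH. Qed.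

Lemma insert_merge_map x f w :
  insert_merge op' (h x) f (map h w) = insert_merge op x (f \o map h) w.
Proof. by elim: w f => //= y w IH f; rewrite hM IH. Qed.

(** Lets words of integers (strip sizes) replace words of powers of [a]. *)
Lemma qshuffle_map t f :
  qshuffle op' (map h t) f = qshuffle op t (f \o map h).
Proof.
elim: t f => //= x t IH f; rewrite IH; congr qshuffle; apply/funext => w.
by rewrite /qinsert /= insert_new_map insert_merge_map.
Qed.

End WordMorphism.

(** * Horizontal strips, interlacing and Bender-Knuth reflections *)

Lemma diagram_cons l lam m mu : diagram (l :: lam) (m :: mu) =
  [seq (0%N, j) | j <- iota m (l - m)] ++
  [seq (b.1.+1, b.2) | b <- diagram lam mu].
Proof.
rewrite /diagram [size _]/= iotaS /=; congr (_ ++ _).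
elim: (iota 0 (size lam)) => //= i s ->; rewrite map_cat; congr (_ ++ _).
by rewrite -map_comp.
Qed.

Lemma includedE mu lam : size mu = size lam ->
  included mu lam = all2 leq mu lam.
Proof.
rewrite /included => eq_s; rewrite eq_s leqnn /=.
elim: mu lam eq_s => [|m mu IH] [|l lam] // [/IH eq_ml].
rewrite [size _]/= iotaS [RHS]/= -eq_ml [LHS]/= all_map.
by congr (_ && _); apply: eq_all => i.
Qed.

Lemma size_all2 (T : Type) (r : rel T) s t : all2 r s t -> size s = size t.
Proof. by elim: s t => [|x s IH] [|y t] //= /andP[_ /IH ->]. Qed.

Lemma leqs_refl s : all2 leq s s.
Proof. by elim: s => //= x s ->; rewrite leqnn. Qed.

Lemma leqs_trans t s u : all2 leq s t -> all2 leq t u -> all2 leq s u.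
Proof.
elim: t s u => [|y t IH] [|x s] [|z u] //= /andP[xy st] /andP[yz tu].
by rewrite (leq_trans xy yz) (IH s u).
Qed.

Lemma leq_sumn s t : all2 leq s t -> (sumn s <= sumn t)%N.
Proof.
by elim: s t => [|x s IH] [|y t] //= /andP[xy /IH]; apply: leq_add.
Qed.

Lemma leqs_sumn_eq s t : all2 leq s t -> (s == t) = (sumn s == sumn t).
Proof.
elim: s t => [|x s IH] [|y t] //= /andP[xy st].
rewrite eqseq_cons (IH _ st); have := leq_sumn st; lia.
Qed.

Lemma size_diagram lam mu : all2 leq mu lam ->
  size (diagram lam mu) = (sumn lam - sumn mu)%N.
Proof.
elim: lam mu => [|l lam IH] [|m mu] //= /andP[ml mulam].
rewrite diagram_cons size_cat !size_map size_iota IH //.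
have := leq_sumn mulam; lia.
Qed.

Fixpoint interlaced (mu lam : seq nat) : bool :=
  match mu, lam with
  | m :: mu', l :: lam' => [&& m <= l, head 0 lam' <= m & interlaced mu' lam']%N
  | [::], [::] => true
  | _, _ => false
  end.

Lemma interlaced_leqs mu lam : interlaced mu lam -> all2 leq mu lam.
Proof.
by elim: mu lam => [|m mu IH] [|l lam] //= /and3P[-> _ /IH].
Qed.

Lemma interlaced_sorted mu lam : interlaced mu lam -> sorted geq lam.
Proof.
elim: mu lam => [|m mu IH] [|l lam] //= /and3P[ml hm /IH].
by case: lam hm => //= l2 lam hm ->; rewrite (leq_trans hm ml).
Qed.

Lemma diagram_cols lam mu b : sorted geq lam -> b \in diagram lam mu ->
  (b.2 < head 0 lam)%N.
Proof.
move=> slam /allpairsPdep[i [j [_ hj ->]]] /=.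
change (is_true (j \in iota (nth 0%N mu i) (nth 0%N lam i - nth 0%N mu i))) in hj.
have := nth_sorted_geq slam (leq0n i); rewrite nth0.
by move: hj; rewrite mem_iota; lia.
Qed.

(** The boxes of the first row lie in columns at least [m], those of the lower rows in columns below
    the second part of the outer shape, which is at most [m]. *)
Lemma interlaced_uniq mu lam : interlaced mu lam ->
  uniq [seq b.2 | b <- diagram lam mu].
Proof.
elim: mu lam => [|m mu IH] [|l lam] //= /and3P[ml hm il].
rewrite diagram_cons map_cat cat_uniq -!map_comp map_id_in // iota_uniq /=.
rewrite -[X in uniq X]/[seq b.2 | b <- diagram lam mu] IH // andbT.
apply/hasPn => _ /mapP[[i j] hb ->] /=; rewrite mem_iota.
have := diagram_cols (interlaced_sorted il) hb => /=; lia.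
Qed.

Lemma uniq_interlaced mu lam : sorted geq mu -> sorted geq lam ->
  all2 leq mu lam -> uniq [seq b.2 | b <- diagram lam mu] -> interlaced mu lam.
Proof.
elim: mu lam => [|m mu IH] [|l lam] //= smu slam /andP[ml mulam].
rewrite diagram_cons map_cat cat_uniq -!map_comp => /and3P[_ hn hu].
apply/and3P; split=> //; last first.
  by apply: IH => //; [apply: path_sorted smu | apply: path_sorted slam].
(* If the second row ended beyond column [m], that column would have a box in each of the first two
   rows. *)
case: mu lam smu slam mulam hn {IH hu} => [|m2 mu] [|l2 lam] //=.
case/andP=> m2m _ /andP[l2l _] /andP[m2l2 _]; apply: contraNleq => ml2.
apply/hasP; exists m; last by rewrite map_id_in // mem_iota /=; lia.
rewrite diagram_cons map_cat mem_cat; apply/orP; left.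
apply/mapP; exists (0%N, m) => //; apply/mapP; exists m => //.
by rewrite mem_iota; lia.
Qed.

Lemma hstripE mu lam : size mu = size lam -> sorted geq mu ->
  hstrip mu lam = interlaced mu lam && (mu != lam).
Proof.
move=> eq_s smu; rewrite /hstrip includedE // [_ && uniq _]andbC !andbA.
congr (_ && _); apply/idP/idP.
  by case/andP=> /andP[slam le_ml]; apply: uniq_interlaced.
by move=> il; rewrite (interlaced_sorted il) (interlaced_leqs il) interlaced_uniq.
Qed.

(** The part [eta_i] ranges over the interval from [max(mu_i, lam_(i+1))] to [min(lam_i, mu_(i-1))],
    independently of the other parts. [u] stands for [mu_(i-1)]; in the top row it is a free upper
    bound. *)
Fixpoint between u (mu lam eta : seq nat) : bool :=
  match mu, lam, eta with
  | m :: mu', l :: lam', e :: eta' =>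
    [&& maxn m (head 0 lam') <= e, e <= minn l u & between m mu' lam' eta']%N
  | [::], [::], [::] => true
  | _, _, _ => false
  end.

(** The Bender-Knuth involution: each part is reflected in its interval. *)
Fixpoint toggle u (mu lam eta : seq nat) : seq nat :=
  match mu, lam, eta with
  | m :: mu', l :: lam', e :: eta' =>
    (maxn m (head 0 lam') + minn l u - e)%N :: toggle m mu' lam' eta'
  | _, _, _ => [::]
  end.

Lemma interlaced_between u mu lam eta :
  [&& interlaced mu eta, interlaced eta lam & head 0 eta <= u]%N =
  between u mu lam eta.
Proof.
elim: mu lam eta u => [|m mu IH] [|l lam] [|e eta] u //=; first by rewrite andbF.
rewrite -IH geq_max leq_min; apply/idP/idP.
  by case/and3P=> /and3P[-> -> ->] /and3P[-> -> ->] ->.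
by case/and3P=> /andP[-> ->] /andP[-> ->] /and3P[-> -> ->].
Qed.

Lemma between_toggle u mu lam eta : between u mu lam eta ->
  between u mu lam (toggle u mu lam eta).
Proof.
elim: mu lam eta u => [|m mu IH] [|l lam] [|e eta] u //= /and3P[h1 h2 /IH ->].
lia.
Qed.

Lemma toggleK u mu lam eta : between u mu lam eta ->
  toggle u mu lam (toggle u mu lam eta) = eta.
Proof.
elim: mu lam eta u => [|m mu IH] [|l lam] [|e eta] u //= /and3P[h1 h2 /IH ->].
congr cons; lia.
Qed.

(** The interval endpoints telescope, as [max(mu_i, lam_(i+1)) + min(lam_(i+1), mu_i) = mu_i +
    lam_(i+1)]; only the top row leaves a correction, which vanishes for [u = head 0 lam]. *)
Lemma sumn_toggle u mu lam eta : between u mu lam eta ->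
  (sumn (toggle u mu lam eta) + sumn eta + head 0 lam =
   sumn mu + sumn lam + minn (head 0 lam) u)%N.
Proof.
elim: mu lam eta u => [|m mu IH] [|l lam] [|e eta] u //=.
  by rewrite min0n.
case/and3P=> h1 h2 /IH; lia.
Qed.

(** * Sums over chains of horizontal strips and their symmetry *)

Fixpoint below (lam : seq nat) : seq (seq nat) :=
  if lam is l :: lam' then
    [seq e :: eta | e <- iota 0 l.+1, eta <- below lam']
  else [:: [::]].

Lemma mem_below lam eta : (eta \in below lam) = all2 leq eta lam.
Proof.
elim: lam eta => [|l lam IH] eta; first by case: eta.
apply/allpairsP/idP => [[[e eta'] [/= he heta ->]]|].
  by rewrite /= -IH heta andbT; move: he; rewrite -[_ :: _]/(iota 0 l.+1) mem_iota.
case: eta => //= e eta /andP[he heta]; exists (e, eta) => /=.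
by rewrite -[_ :: iota _ _]/(iota 0 l.+1) mem_iota IH.
Qed.

Lemma below_uniq lam : uniq (below lam).
Proof.
elim: lam => // l lam IH; apply: allpairs_uniq => //; first exact: iota_uniq.
by move=> [e eta] [e' eta'] _ _ [-> ->].
Qed.

Lemma hstrip_leqs mu lam : size mu = size lam -> hstrip mu lam ->
  all2 leq mu lam && (sumn mu < sumn lam)%N.
Proof.
move=> eq_s /and4P[_]; rewrite includedE // => le_ml ne_ml _.
by rewrite le_ml ltn_neqAle leq_sumn // -leqs_sumn_eq // ne_ml.
Qed.

Section ChainSums.
Variables (V : zmodType) (lam : seq nat).

(** The sum of [f] over the chains of [r] nonempty horizontal strips from [mu]
    to [lam], [f] being applied to the word of the weights of the strips. *)
Fixpoint chainsum (T : Type) (wt : seq nat -> seq nat -> T) r mu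
    (f : seq T -> V) : V :=
  if r is r'.+1 then
    \sum_(eta <- below lam | hstrip mu eta)
      chainsum wt r' eta (f \o cons (wt mu eta))
  else if mu == lam then f [::] else 0.

Lemma chainsumS (T : Type) (wt : seq nat -> seq nat -> T) r mu f :
  chainsum wt r.+1 mu f = \sum_(eta <- below lam | hstrip mu eta)
    chainsum wt r eta (f \o cons (wt mu eta)).
Proof. by []. Qed.

Lemma eq_chainsum_next mu (F G : seq nat -> V) :
  size mu = size lam ->
  (forall eta, size eta = size lam -> all2 leq mu eta -> all2 leq eta lam ->
     (sumn mu < sumn eta)%N -> hstrip mu eta -> F eta = G eta) ->
  \sum_(eta <- below lam | hstrip mu eta) F eta =
  \sum_(eta <- below lam | hstrip mu eta) G eta.
Proof.
move=> eq_s FG; rewrite big_seq_cond [RHS]big_seq_cond.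
apply: eq_bigr => eta; rewrite mem_below => /andP[le_el st].
have eq_e := size_all2 le_el.
by case/andP: (hstrip_leqs (etrans eq_s (esym eq_e)) st) => *; apply: FG.
Qed.

Lemma chainsumD (T : Type) (wt : seq nat -> seq nat -> T) r mu f g :
  chainsum wt r mu (fun w => f w + g w) =
  chainsum wt r mu f + chainsum wt r mu g.
Proof.
elim: r mu f g => [|r IH] mu f g /=; first by case: eqP; rewrite ?addr0.
by rewrite -big_split; apply: eq_bigr => eta _; rewrite /= -IH.
Qed.

Lemma chainsum_sum (T : Type) (wt : seq nat -> seq nat -> T) r mu
    (I : Type) (s : seq I) (F : I -> seq T -> V) :
  chainsum wt r mu (fun w => \sum_(i <- s) F i w) =
  \sum_(i <- s) chainsum wt r mu (F i).
Proof.
elim: r mu F => [|r IH] mu F /=; first by case: eqP => // _; rewrite big1.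
by rewrite [RHS]exchange_big; apply: eq_bigr => eta _; apply: IH.
Qed.

Lemma chainsum_closed (T : Type) (wt : seq nat -> seq nat -> T) (P : V -> Prop)
    r mu f : P 0 -> (forall v v', P v -> P v' -> P (v + v')) ->
  (forall w, size w = r -> P (f w)) -> P (chainsum wt r mu f).
Proof.
move=> P0 PD; elim: r mu f => [|r IH] mu f Pf /=.
  by case: eqP => // _; apply: Pf.
elim/big_ind: _ => // eta _; apply: IH => w sw; apply: Pf.
by rewrite /= sw.
Qed.

Lemma chainsum_out (T : Type) (wt : seq nat -> seq nat -> T) r mu f :
  size mu = size lam -> ~~ all2 leq mu lam -> chainsum wt r mu f = 0.
Proof.
move=> eq_s nle; case: r f => [|r] f /=.
  by case: eqP nle => // ->; rewrite leqs_refl.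
rewrite (eq_chainsum_next (G := fun=> 0)) ?big1 // => eta _ h1 h2 _ _.
by rewrite (leqs_trans h1 h2) in nle.
Qed.

(** Every strip of a chain has at least one box. *)
Lemma chainsum_long (T : Type) (wt : seq nat -> seq nat -> T) r mu f :
  size mu = size lam -> (sumn lam < sumn mu + r)%N -> chainsum wt r mu f = 0.
Proof.
elim: r mu f => [|r IH] mu f eq_s /= lt.
  by case: eqP lt => // ->; rewrite addn0 ltnn.
rewrite (eq_chainsum_next (G := fun=> 0)) ?big1 // => eta h _ _ lt' _.
by apply: IH => //; lia.
Qed.

(** The lower bound [kap] confines the comparison of weights to strips inside a fixed skew
    diagram. *)
Lemma chainsum_map (T T' : Type) (wt : seq nat -> seq nat -> T)
    (wt' : seq nat -> seq nat -> T') (h : T -> T') kap r mu f :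
  (forall mu eta, all2 leq kap mu -> all2 leq mu eta -> all2 leq eta lam ->
     (sumn mu < sumn eta)%N -> wt' mu eta = h (wt mu eta)) ->
  size mu = size lam -> all2 leq kap mu ->
  chainsum wt' r mu f = chainsum wt r mu (f \o map h).
Proof.
move=> hwt; elim: r mu f => [|r IH] mu f eq_s le_km //=.
apply: eq_chainsum_next => // eta s1 h1 h2 lt _; rewrite (hwt mu) //.
by rewrite IH // (leqs_trans le_km).
Qed.

(** The weight [l] stands for a strip with [l.+1] boxes. *)
Definition strip_size (mu lam : seq nat) := (sumn lam - sumn mu).-1.

(** The reflection permutes the possible middle shapes between [mu] and [eta] and exchanges the two
    strip sizes. The bound [head 0 eta] on the first part already follows from interlacing. *)
Lemma perm_toggle mu eta : size mu = size lam -> sorted geq mu ->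
  all2 leq eta lam ->
  let s := [seq z <- below lam | hstrip mu z && hstrip z eta] in
  let t := toggle (head 0%N eta) mu eta in
  perm_eq (map t s) s /\
  {in s, forall z, sumn (t z) + sumn z = sumn mu + sumn eta}%N.
Proof.
move=> eq_s smu le_el s t; pose P z := hstrip mu z && hstrip z eta.
(* Nonemptiness of both strips is expressed by strict inequalities between sums, which the
   reflection visibly preserves. *)
have PE z : (z \in s) =
    between (head 0%N eta) mu eta z && (sumn mu < sumn z < sumn eta)%N.
  rewrite mem_filter mem_below /P.
  have [sz|nsz] := eqVneq (size z) (size lam); last first.
    transitivity false.
      by apply/negbTE/negP=> /andP[_ /size_all2]; apply/eqP.
    apply/esym/negbTE/negP; rewrite -interlaced_between.
    case/andP=> /and3P[/interlaced_leqs/size_all2 h _ _] _.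
    by rewrite -h eq_s eqxx in nsz.
  have smz : size mu = size z by rewrite sz.
  have sze : size z = size eta by rewrite sz (size_all2 le_el).
  rewrite -interlaced_between hstripE //.
  apply/idP/idP.
    case/andP=> /andP[/andP[h1 h2] h3] h4.
    rewrite hstripE ?(interlaced_sorted h1) // in h3.
    case/andP: h3 => h3 h5; rewrite h1 h3 /=.
    have := interlaced_leqs h1; have := interlaced_leqs h3 => l1 l2.
    rewrite !ltn_neqAle !leq_sumn // -!leqs_sumn_eq // h2 h5 !andbT.
    by case: (z) (eta) l1 => [|a z'] [|b e'] //= /andP[].
  case/andP=> /and3P[h1 h2 h3] /andP[h4 h5].
  rewrite h1 hstripE ?(interlaced_sorted h1) // h2 /=.
  rewrite (leqs_trans (interlaced_leqs h2) le_el) andbT; apply/andP; split.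
    by apply: contraTneq h4 => ->; rewrite ltnn.
  by apply: contraTneq h5 => ->; rewrite ltnn.
have sumt z : between (head 0%N eta) mu eta z ->
    (sumn (t z) + sumn z = sumn mu + sumn eta)%N.
  by move/sumn_toggle; rewrite minnn -/t; lia.
have tP z : z \in s ->
    t z \in s.
  rewrite !PE => /andP[bz lt]; rewrite between_toggle //=.
  by have := sumt z bz; lia.
have tK z : z \in s -> t (t z) = z.
  by rewrite PE => /andP[bz _]; apply: toggleK.
split; last by move=> z; rewrite PE => /andP[/sumt].
apply: uniq_perm; last 1 first.
- move=> z; apply/mapP/idP => [[y hy ->]|hz]; first exact: tP.
  by exists (t z); [apply: tP | rewrite tK].
- rewrite map_inj_in_uniq ?filter_uniq ?below_uniq // => y z hy hz eq_t.
  by rewrite -(tK y hy) -(tK z hz) eq_t.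
- by rewrite filter_uniq ?below_uniq.
Qed.

Lemma chainsum_swap j r mu f : size mu = size lam -> sorted geq mu ->
  chainsum strip_size r mu (f \o swap j) = chainsum strip_size r mu f.
Proof.
elim: r j mu f => [|r IH] [|j] mu f eq_s smu //=; last first.
  apply: eq_chainsum_next => // eta s1 _ _ _ st.
  rewrite -[RHS](IH j) //; by case/and4P: st.
(* A one-letter word is fixed by [swap 0]. *)
case: r {IH} => [|r] //=.
(* Fix the shape [eta] reached after two strips and reindex the middle shape by the reflection. *)
rewrite (exchange_big_dep xpredT) //= [RHS](exchange_big_dep xpredT) //=.
apply: eq_big_seq => eta.
rewrite mem_below => le_el.
have [pt sum_t] := perm_toggle eq_s smu le_el.
rewrite -big_filter -[RHS]big_filter -[LHS](perm_big _ pt) big_map.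
apply: eq_big_seq => z /sum_t sum_tz /=; congr chainsum.
apply/funext => w /=; rewrite /strip_size.
set z' := toggle _ _ _ _ in sum_tz *.
have -> : ((sumn eta - sumn z').-1 = (sumn z - sumn mu).-1)%N by lia.
by have -> : ((sumn z' - sumn mu).-1 = (sumn eta - sumn z).-1)%N by lia.
Qed.

Lemma chainsum_act js r mu f : size mu = size lam -> sorted geq mu ->
  chainsum strip_size r mu (f \o act js) = chainsum strip_size r mu f.
Proof.
move=> eq_s smu; elim: js f => [|j js IH] f; first by congr chainsum.
by rewrite -[RHS]IH -[RHS](chainsum_swap j).
Qed.

(** All [r!] permutations give the same sum; this is where the denominator [r!] arises. *)
Lemma chainsum_symsum r mu f : size mu = size lam -> sorted geq mu ->
  chainsum strip_size r mu (symsum r f) = chainsum strip_size r mu f *+ r`!.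
Proof.
move=> eq_s smu; rewrite chainsum_sum -(size_perms r).
under eq_bigr do rewrite (chainsum_act _ _ _ eq_s smu).
by rewrite big_const_seq count_predT iter_addr_0.
Qed.

End ChainSums.

(** * From sums over tuples to recursive chain sums *)

Lemma big_tupleS (T : finType) (V : zmodType) r (F : seq T -> V) :
  \sum_(c : r.+1.-tuple T) F c = \sum_(x : T) \sum_(c : r.-tuple T) F (x :: c).
Proof.
rewrite pair_bigA /= (reindex (fun p : T * r.-tuple T => [tuple of p.1 :: p.2])) //.
exists (fun c : r.+1.-tuple T => (thead c, [tuple of behead c])) => [[x c] _|c _].
  by congr pair; apply/val_inj.
by rewrite -tuple_eta.
Qed.

Section ChainTuples.
Variables (V : zmodType) (T : Type) (wt : seq nat -> seq nat -> T).
Variables (lam : seq nat) (N : nat) (lamN : all (fun l => (l < N)%N) lam).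

Local Notation row := ((size lam).-tuple 'I_N).
Local Notation parts eta := (map val (tval (eta : row))).

(** Tuples with entries below [N] include all sequences of [below lam]; the others contribute zero
    by the assumption on [G]. *)
Lemma big_row (P : pred (seq nat)) (G : seq nat -> V) :
  (forall eta, size eta = size lam -> ~~ all2 leq eta lam -> G eta = 0) ->
  \sum_(x : row | P (parts x)) G (parts x) = \sum_(eta <- below lam | P eta) G eta.
Proof.
move=> G0; rewrite -(big_map (fun x : row => parts x) P G).
set rows := [seq parts x | x <- _].
have Urows : uniq rows.
  rewrite map_inj_uniq ?index_enum_uniq // => x y /inj_map/val_inj-> //.
  exact: val_inj.
have mem_rows eta : all2 leq eta lam -> eta \in rows.
  move=> le_el; have eq_e := size_all2 le_el.
  have eN : all (fun e => (e < N)%N) eta.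
    apply/allP => e /(nthP 0%N)[i lt_i <-].
    apply: leq_ltn_trans (allP lamN (nth 0%N lam i) _); last first.
      by rewrite mem_nth // -eq_e.
    elim: (eta) (lam) i le_el lt_i {eq_e} => [|a e' IH] [|b l'] [|i] //=
      /andP[ab le_el] //.
    exact: IH.
  have se : size (pmap insub eta : seq 'I_N) == size lam.
    by rewrite size_pmap_sub -eq_e -all_count.
  apply/mapP; exists (Tuple se); first exact: mem_index_enum.
  rewrite /= (pmap_filter (insubK _)) (all_filterP _) //.
  by rewrite (eq_all (a2 := fun e => (e < N)%N)) // => e; rewrite isSome_insub.
have perm_rows : perm_eq [seq eta <- rows | all2 leq eta lam] (below lam).
  apply: uniq_perm; rewrite ?filter_uniq ?below_uniq // => eta.
  rewrite mem_filter mem_below; case: (boolP (all2 leq eta lam)) => //= le_el.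
  exact: mem_rows.
rewrite -(perm_big _ perm_rows) /= big_filter_cond (bigID (all2 leq ^~ lam)) /=.
rewrite [X in _ + X]big1_seq ?addr0 => [|eta /andP[/andP[_ nle] /mapP[x _ eq_e]]].
  by apply: eq_bigl => eta; rewrite andbC.
by apply: G0; rewrite // eq_e size_map size_tuple.
Qed.

(** Replaces the sum over tuples in [Ltab] by one that allows induction on the first strip. *)
Lemma chain_tuples r mu (F : seq T -> V) : size mu = size lam ->
  \sum_(c : r.-tuple row | is_SSD lam mu (chain_of c))
     F (pairmap wt mu (chain_of c)) = chainsum lam wt r mu F.
Proof.
rewrite big_mkcond; elim: r mu F => [|r IH] mu F eq_s.
  rewrite (big_pred1 [tuple]) ?{1}/is_SSD //= => c.
  by apply/esym/eqP; rewrite [c]tuple0.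
pose Fc (c : seq row) :=
  let etas := [seq parts eta | eta <- c] in
  if is_SSD lam mu etas then F (pairmap wt mu etas) else 0.
rewrite (big_tupleS r Fc) /= -big_row; last first.
  by move=> eta se nle; apply: chainsum_out.
rewrite [RHS]big_mkcond; apply: eq_bigr => x _; rewrite /Fc /=.
case: ifP => st; last by rewrite big1 // => c _; rewrite /is_SSD /= st.
rewrite -IH ?size_map ?size_tuple //; apply: eq_bigr => c _.
by rewrite /is_SSD /= st.
Qed.

End ChainTuples.

(** * Strips of a tableau and the removal of a disconnected first box *)

Section TableauChains.
Variables (k : comNzRingType) (A : choiceType).
Variable diam : {malg k[A]} -> {malg k[A]} -> {malg k[A]}.
Hypothesis diamA : associative diam.

Local Notation kA := {malg k[A]}.
Local Notation kAw := {malg k[{fmonom A}]}.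

Definition word_val (w : seq kA) : kAw := \prod_(x <- w) letter x.

Definition strip_entries (h : seq (nat * seq A)) mu lam : seq A :=
  pmap (entry h) (diagram lam mu).

Definition strip_prod (h : seq (nat * seq A)) mu lam : kA :=
  dprod diam [seq << a >> | a <- strip_entries h mu lam].

Lemma strip_entries_cons (r : nat * seq A) h m mu l lam :
  strip_entries (r :: h) (m :: mu) (l :: lam) =
  pmap (fun j => onth r.2 (j - r.1)) (iota m (l - m)) ++
  strip_entries h mu lam.
Proof.
rewrite /strip_entries diagram_cons pmap_cat; congr (_ ++ _).
  by elim: (iota _ _) => //= j s ->.
by elim: (diagram _ _) => //= b s ->.
Qed.

Lemma size_strip_entries (h : seq (nat * seq A)) mu lam :
  all2 leq (inner h) mu -> all2 leq mu lam -> all2 leq lam (outer h) ->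
  size (strip_entries h mu lam) = (sumn lam - sumn mu)%N.
Proof.
elim: h mu lam => [|[p ws] h IH] [|m mu] [|l lam] //=.
move=> /andP[pm h1] /andP[ml h2] /andP[lp h3].
have sz : size (pmap (fun j => onth ws (j - p)) (iota m (l - m))) = (l - m)%N.
  rewrite size_pmap -[RHS](size_iota m); apply/eqP.
  by rewrite -all_count; apply/allP => j; rewrite mem_iota /= onthTE; lia.
rewrite strip_entries_cons size_cat IH //= sz.
have := leq_sumn h2; lia.
Qed.

Lemma dprod_cons x s : s != [::] -> dprod diam (x :: s) = diam x (dprod diam s).
Proof.
case: s => //= y s _.
by elim: s x y => //= z s IH x y; rewrite -diamA IH.
Qed.

End TableauChains.

Lemma big_below_cons (V : nmodType) (P : pred (seq nat)) (F : seq nat -> V) l lam :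
  \sum_(eta <- below (l :: lam) | P eta) F eta =
  \sum_(e <- iota 0 l.+1) \sum_(eta <- below lam | P (e :: eta)) F (e :: eta).
Proof.
rewrite big_mkcond big_allpairs_dep; apply: eq_bigr => e _.
by rewrite -big_mkcond.
Qed.

Lemma leq_head s t : all2 leq s t -> (head 0 s <= head 0 t)%N.
Proof. by case: s t => [|x s] [|y t] //= /andP[]. Qed.

Section FirstRow.
Variables (V : zmodType) (lam mu : seq nat) (p : nat).
Hypotheses (le_ml : all2 leq mu lam) (smu : sorted geq mu).
Hypothesis lam_p : (head 0 lam <= p)%N.
Implicit Type F : seq nat -> V.

(** The first row lies to the right of all the others, since [head 0 eta <= head 0 lam <= p <= m]:
    its interlacing condition with the second row is automatic. *)
Lemma hstrip_cons m e eta : (p <= m)%N -> all2 leq eta lam ->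
  hstrip (m :: mu) (e :: eta) =
  [&& (m <= e)%N, interlaced mu eta & (m != e) || (mu != eta)].
Proof.
move=> pm le_el.
rewrite hstripE /= ?(size_all2 le_ml) ?(size_all2 le_el) //; last first.
  by case: (mu) smu (leq_head le_ml) => //= x s ->; rewrite andbT; lia.
have -> : (head 0 eta <= m)%N by have := leq_head le_el; lia.
by rewrite eqseq_cons negb_and -andbA.
Qed.

Lemma interlaced_hstrip eta : all2 leq eta lam -> mu != eta ->
  interlaced mu eta = hstrip mu eta.
Proof.
move=> le_el ne; rewrite hstripE ?ne ?andbT //.
by rewrite (size_all2 le_ml) (size_all2 le_el).
Qed.

Lemma interlaced_refl : interlaced mu mu.
Proof.
elim: (mu) smu => //= m s IH sms; rewrite leqnn IH ?(path_sorted sms) // andbT.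
by case: (s) sms => //= x s' /andP[].
Qed.

Lemma big_filled_row F :
  \sum_(eta <- below (p.+1 :: lam) | hstrip (p.+1 :: mu) eta) F eta =
  \sum_(eta <- below lam | hstrip mu eta) F (p.+1 :: eta).
Proof.
rewrite big_below_cons -[p.+2]addn1 iotaD big_cat /= big_seq1 [X in X + _]big1_seq.
  rewrite add0r big_seq_cond [RHS]big_seq_cond; apply: eq_bigl => eta.
  rewrite mem_below; case: (boolP (all2 _ _ _)) => //= le_el.
  rewrite hstrip_cons // leqnn eqxx /=.
  by have [<-|/interlaced_hstrip->] := eqVneq;
    rewrite ?andbF ?andbT // /hstrip eqxx !andbF.
move=> e; rewrite -[_ :: _]/(iota 0 p.+1) mem_iota /= => lt_e.
rewrite big1_seq // => eta; rewrite mem_below => /andP[st le_el]; move: st; rewrite hstrip_cons //; lia.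
Qed.

(** The three terms: the next strip avoids the box of the first row, consists of it alone, or
    contains it together with other boxes. *)
Lemma big_empty_row F :
  \sum_(eta <- below (p.+1 :: lam) | hstrip (p :: mu) eta) F eta =
  \sum_(eta <- below lam | hstrip mu eta) F (p :: eta) +
  (F (p.+1 :: mu) + \sum_(eta <- below lam | hstrip mu eta) F (p.+1 :: eta)).
Proof.
rewrite big_below_cons -[p.+2]addn2 iotaD big_cat /= big_cons big_seq1.
rewrite [X in X + _]big1_seq ?add0r => [|e]; last first.
  rewrite mem_iota /= => lt_e; rewrite big1_seq // => eta.
  rewrite mem_below => /andP[st le_el]; move: st; rewrite hstrip_cons //; lia.
congr (_ + _).
  rewrite big_seq_cond [RHS]big_seq_cond; apply: eq_bigl => eta.
  rewrite mem_below; case: (boolP (all2 _ _ _)) => //= le_el.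
  rewrite hstrip_cons // leqnn eqxx /=.
  by have [<-|/interlaced_hstrip->] := eqVneq;
    rewrite ?andbF ?andbT // /hstrip eqxx !andbF.
have mu_in : mu \in below lam by rewrite mem_below.
rewrite big_mkcond (bigD1_seq mu) ?below_uniq //=.
rewrite [X in _ = _ + X]big_mkcond [X in _ = _ + X](bigD1_seq mu) ?below_uniq //=.
rewrite hstrip_cons // leqnSn interlaced_refl neq_ltn ltnSn /=; congr (_ + _).
have -> : hstrip mu mu = false by rewrite /hstrip eqxx !andbF.
rewrite add0r big_seq_cond [RHS]big_seq_cond; apply: eq_bigr => eta.
rewrite mem_below => /andP[le_el ne]; rewrite hstrip_cons // leqnSn.
by rewrite neq_ltn ltnSn andbT interlaced_hstrip // eq_sym.
Qed.

End FirstRow.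

Section AddBox.
Variables (k : comNzRingType) (A : choiceType).
Variable diam : {malg k[A]} -> {malg k[A]} -> {malg k[A]}.
Hypothesis diamA : associative diam.
Variable V : zmodType.
Variables (b : A) (p : nat) (h : seq (nat * seq A)).
Hypothesis h_p : (head 0 (outer h) <= p)%N.
Implicit Type f : seq {malg k[A]} -> V.

Local Notation hb := ((p, [:: b]) :: h).
Local Notation x := (<< b >> : {malg k[A]}).

Lemma strip_prod_empty mu eta :
  strip_prod diam hb (p :: mu) (p :: eta) = strip_prod diam h mu eta.
Proof. by rewrite /strip_prod strip_entries_cons subnn. Qed.

Lemma strip_prod_filled mu eta :
  strip_prod diam hb (p.+1 :: mu) (p.+1 :: eta) = strip_prod diam h mu eta.
Proof. by rewrite /strip_prod strip_entries_cons subnn. Qed.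

Lemma strip_prod_fill mu eta :
  all2 leq (inner h) mu -> all2 leq mu eta -> all2 leq eta (outer h) ->
  strip_prod diam hb (p :: mu) (p.+1 :: eta) =
  if sumn mu == sumn eta then x else diam x (strip_prod diam h mu eta).
Proof.
move=> h1 h2 h3; rewrite /strip_prod strip_entries_cons.
have -> : pmap (fun j => onth [:: b] (j - p)) (iota p (p.+1 - p)) = [:: b].
  by rewrite subSnn /= subnn.
rewrite map_cat cat1s; have := size_strip_entries h1 h2 h3; case: eqP => [->|ne] sz.
  by rewrite subnn in sz; rewrite (size0nil sz).
rewrite dprod_cons // -size_eq0 size_map sz; have := leq_sumn h2; lia.
Qed.

Lemma chainsum_filled r mu f : all2 leq mu (outer h) -> sorted geq mu ->
  chainsum (p.+1 :: outer h) (strip_prod diam hb) r (p.+1 :: mu) f =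
  chainsum (outer h) (strip_prod diam h) r mu f.
Proof.
elim: r mu f => [|r IH] mu f le_mh smu; first by rewrite /= eqseq_cons eqxx.
rewrite [LHS]/= big_filled_row // ; apply: eq_chainsum_next => [|eta _ _ h2 _ st].
  exact: size_all2 le_mh.
by rewrite strip_prod_filled IH //; case/and4P: st.
Qed.

(** Removing the first box, which shares no row and no column with the other
    ones, from a chain leaves a chain with one strip fewer if the box was a
    strip by itself, and with the same number of strips otherwise. *)
Lemma chainsum_empty r mu f : all2 leq (inner h) mu -> all2 leq mu (outer h) ->
  sorted geq mu ->
  chainsum (p.+1 :: outer h) (strip_prod diam hb) r.+1 (p :: mu) f =
  chainsum (outer h) (strip_prod diam h) r mu (insert_new x f) +
  chainsum (outer h) (strip_prod diam h) r.+1 mu (insert_merge diam x f).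
Proof.
pose CS r mu (f : seq {malg k[A]} -> V) :=
  chainsum (outer h) (strip_prod diam h) r mu f.
(* The insertions of [x] anywhere but at the head. *)
pose later f w := if w is y :: w' then insert_new x (f \o cons y) w' else 0.
have newE s nu g : CS s nu (insert_new x g) =
    CS s nu (g \o cons x) + CS s nu (later g).
  by rewrite /CS -chainsumD; congr chainsum; apply/funext => -[|y w].
(* In both cases of the induction, the term where the box alone is the first strip cancels against
   the insertion of [x] at the head. *)
rewrite -!/(CS _ _ _); elim: r mu f => [|r IH] mu f h1 h2 smu;
  have eq_s := size_all2 h2; rewrite newE chainsumS big_empty_row //;
  rewrite [X in _ + (X + _)]chainsum_filled // strip_prod_fill ?leqs_refl //;
  rewrite eqxx -/(CS _ _ _) addrCA -addrA; congr (_ + _).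
  rewrite big1 ?add0r => [|eta _]; last by rewrite /= eqseq_cons ltn_eqF.
  rewrite [X in X + _](_ : _ = 0) ?add0r; last by rewrite /CS /=; case: eqP.
  apply: eq_chainsum_next => // eta se le_me le_eh lt st.
  rewrite strip_prod_fill ?ltn_eqF //= eqseq_cons eqxx /=.
  by case: eqP => // _; rewrite addr0.
(* Compare the rest for each end [eta] of the first strip of the remaining shape: a strip avoiding
   the box gives, by induction, the later insertions and merges; a strip containing it gives the
   merge with the first letter. *)
rewrite /CS [X in _ = X + _]chainsumS [X in _ = _ + X]chainsumS -!big_split.
apply: eq_chainsum_next => //.
move=> eta se le_me le_eh lt st; have seta : sorted geq eta by case/and4P: st.
rewrite IH ?(leqs_trans h1) //.
rewrite strip_prod_empty strip_prod_fill // ltn_eqF // chainsum_filled //.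
set sp := strip_prod _ _ _ _.
have -> : chainsum (outer h) (strip_prod diam h) r.+1 eta
    (insert_merge diam x f \o cons sp) =
    CS r.+1 eta (f \o cons (diam x sp)) +
    CS r.+1 eta (insert_merge diam x (f \o cons sp)).
  by rewrite /CS -chainsumD.
by rewrite [CS _ _ (f \o cons (diam _ _)) + _]addrC; apply: esym (addrA _ _ _).
Qed.

End AddBox.

Lemma sumn_mkseq_nth s n : (size s <= n)%N -> sumn (mkseq (nth 0%N s) n) = sumn s.
Proof.
rewrite /mkseq; elim: n s => [|n IH] [|x s] // le_sn; rewrite iotaS /= -map_comp.
  by rewrite -[RHS](IH [::]) //; congr sumn; apply: eq_map => i /=; rewrite nth_nil.
by rewrite -[in RHS](IH s).
Qed.

(** * Linearizations of antidiagonal and of constant tableaux *)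

Section TableauSums.
Variables (k : comNzRingType) (A : choiceType).
Variable diam : {malg k[A]} -> {malg k[A]} -> {malg k[A]}.
Hypothesis diamA : associative diam.

Local Notation kA := {malg k[A]}.
Local Notation kAw := {malg k[{fmonom A}]}.

Lemma inner_outer (h : seq (nat * seq A)) : all2 leq (inner h) (outer h).
Proof. by elim: h => //= r h ->; rewrite leq_addr. Qed.

Definition tabsum (V : zmodType) (h : seq (nat * seq A)) (f : seq kA -> V) : V :=
  \sum_(r < (sumn (outer h) - sumn (inner h)).+1)
    chainsum (outer h) (strip_prod diam h) r (inner h) f.

Lemma word_val_pairmap (g : seq nat -> seq nat -> kA) mu etas :
  \prod_(w <- pairmap (fun eta nu => letter (g eta nu)) mu etas) w =
  word_val (pairmap g mu etas).
Proof.
rewrite /word_val; elim: etas mu => [|eta etas IH] mu /=; first by rewrite !big_nil.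
by rewrite !big_cons IH.
Qed.

Lemma Ltab_tabsum (h : YT A) : Ltab diam h = tabsum h (@word_val k A).
Proof.
rewrite /tabsum -size_diagram ?inner_outer //; apply: eq_bigr => r _.
have lamN : all (fun l => (l < (head 0 (outer h)).+1)%N) (outer h).
  apply/(all_nthP 0%N) => i lt_i; rewrite ltnS -nth0.
  by case/and3P: (rowsP h) => _ so _; apply: (nth_sorted_geq so).
rewrite -(chain_tuples _ lamN _ _ (size_all2 (inner_outer h))).
by apply: eq_bigr => c _; apply: word_val_pairmap.
Qed.

(** Summing [chainsum_empty] over all lengths turns a disconnected first box into a quasi-shuffle
    factor [b]. *)
Lemma tabsum_box (V : zmodType) b p (h : seq (nat * seq A)) (f : seq kA -> V) :
  (head 0 (outer h) <= p)%N -> sorted geq (inner h) ->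
  tabsum ((p, [:: b]) :: h) f = tabsum h (qinsert diam << b >> f).
Proof.
move=> h_p si; have io := inner_outer h; rewrite /tabsum /= addn1.
have -> : (p.+1 + sumn (outer h) - (p + sumn (inner h)) =
           (sumn (outer h) - sumn (inner h)).+1)%N by have := leq_sumn io; lia.
set d := (sumn (outer h) - sumn (inner h))%N.
(* No chain has length 0, since the box must be filled. *)
rewrite big_ord_recl [X in X + _](_ : _ = 0); last first.
  by rewrite /= eqseq_cons ltn_eqF.
rewrite add0r.
pose CS r (g : seq kA -> V) :=
  chainsum (outer h) (strip_prod diam h) r (inner h) g.
(* The boundary terms vanish: the empty word has no letter to merge with, and [d] boxes cannot form
   [d.+1] nonempty strips. *)
have merge_sum : \sum_(r < d.+1) CS r.+1 (insert_merge diam << b >> f) =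
    \sum_(r < d.+1) CS r (insert_merge diam << b >> f).
  transitivity (\sum_(r < d.+2) CS r (insert_merge diam << b >> f)).
    rewrite [RHS]big_ord_recl /CS [X in _ = X + _](_ : _ = 0) ?add0r //=.
    by case: eqP.
  rewrite big_ord_recr /= [X in _ + X]chainsum_long ?addr0 //.
    by rewrite (size_all2 io).
  rewrite /d; lia.
rewrite (eq_bigr (fun i : 'I_d.+1 => CS i (insert_new << b >> f) +
  CS i.+1 (insert_merge diam << b >> f))) => [|i _]; last first.
  by apply: chainsum_empty; rewrite ?leqs_refl.
rewrite big_split /= merge_sum -big_split.
by apply: eq_bigr => r _; rewrite /= /CS -chainsumD.
Qed.

Fixpoint antidiag_rows (bs : seq A) : seq (nat * seq A) :=
  if bs is b :: bs' then (size bs', [:: b]) :: antidiag_rows bs' else [::].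

Lemma head_outer_antidiag bs : head 0%N (outer (antidiag_rows bs)) = size bs.
Proof. by case: bs => //= b bs; rewrite addn1. Qed.

Lemma sorted_inner_antidiag bs : sorted geq (inner (antidiag_rows bs)).
Proof. by elim: bs => //= b [|b' bs] //= ->; rewrite leqnSn. Qed.

Lemma antidiag_rowsP bs : is_tableau (antidiag_rows bs).
Proof.
rewrite /is_tableau sorted_inner_antidiag /=; apply/andP; split.
  by elim: bs => //= b [|b' bs] //= ->; rewrite !addn1 leqnSn.
by elim: bs => //= b bs; rewrite inE addn1.
Qed.

(** The skew tableau of [size bs] pairwise disconnected boxes, whose class is
    the product of the one-box tableaux. *)
Definition antidiag bs : YT A := MkYT (antidiag_rowsP bs).

Lemma Ltab_antidiag bs : Ltab diam (antidiag bs) =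
  qshuffle diam [seq << b >> | b <- bs] (@word_val k A).
Proof.
rewrite Ltab_tabsum /=; elim: bs (@word_val k A) => [|b bs IH] f /=.
  by rewrite /tabsum big_ord_recl big_ord0 addr0.
by rewrite tabsum_box ?head_outer_antidiag ?sorted_inner_antidiag.
Qed.

(** Each row starts in the column where the next one ends, so there is a cut after every row. *)
Lemma SC_antidiag bs : SC (antidiag bs) = map (@box1 A) bs.
Proof.
apply: (inj_map val_inj); rewrite [LHS]rows_SC /SC_rows /=.
elim: bs => //= b bs IH; rewrite -[nth _ _ _]/(nth 0%N (outer (antidiag_rows bs)) 0).
by rewrite nth0 head_outer_antidiag leqnn /= IH /translate /= subnn.
Qed.

Lemma dprod_cat s t : s != [::] -> t != [::] ->
  dprod diam (s ++ t) = diam (dprod diam s) (dprod diam t).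
Proof.
case: s => // x s _ nt; rewrite /= foldl_cat.
exact: (dprod_cons diamA (foldl diam x s) nt).
Qed.

Variable a : A.

(** The shift matches [strip_size]: merging the letters [l] and [m] yields [(l + m).+1]. *)
Definition dpowS l := dpow diam a l.+1.

Lemma dpowS_add l m : dpowS (l + m).+1 = diam (dpowS l) (dpowS m).
Proof. by rewrite /dpowS /dpow -dprod_cat // -nseqD addSn addnS. Qed.

Lemma strip_prod_const lam mu (hs : skew_shape lam mu) eta nu :
  all2 leq (inner (const_tab hs a)) eta -> all2 leq eta nu -> all2 leq nu lam ->
  (sumn eta < sumn nu)%N ->
  strip_prod diam (const_tab hs a) eta nu = dpowS (strip_size eta nu).
Proof.
move=> h1 h2 h3 lt.
have ol : outer (const_tab hs a) = lam.
  by case/and3P: (hs) => _ _; apply: outer_tabulate.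
have := size_strip_entries h1 h2; rewrite ol => /(_ h3) sz.
(* The strip is nonempty, so the predecessor in [strip_size] and the successor in [dpowS] cancel. *)
rewrite /strip_prod /dpowS /dpow /strip_size prednK ?subn_gt0 // -sz.
congr dprod; rewrite -(map_nseq _ (fun b : A => << b >> : kA)); congr map.
apply/all_pred1P/allP => x; rewrite mem_pmap => /mapP[[i j] _] /= /esym.
rewrite /entry /tabulate; case: (ltnP i (size lam)) => lt_i; last first.
  by rewrite nth_default ?size_mkseq // onth0n.
by rewrite nth_mkseq //= onth_nseq; case: ifP => // _ [<-].
Qed.

(** With equal entries the weight of a strip depends on its size only, which brings the sum under
    [chainsum_symsum]. *)
Lemma Ltab_const lam mu (hs : skew_shape lam mu) :
  Ltab diam (const_tab hs a) =
  \sum_(r < (sumn lam - sumn mu).+1)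
    chainsum lam strip_size r (inner (const_tab hs a))
      (@word_val k A \o map dpowS).
Proof.
have ol : outer (const_tab hs a) = lam.
  by case/and3P: (hs) => _ _; apply: outer_tabulate.
have io := inner_outer (const_tab hs a); rewrite ol in io.
rewrite Ltab_tabsum /tabsum ol.
have -> : sumn (inner (const_tab hs a)) = sumn mu.
  rewrite inner_tabulate; case/and3P: (hs) => _ _ /andP[le_s _].
  exact: sumn_mkseq_nth.
apply: eq_bigr => r _.
apply: (@chainsum_map _ _ _ _ _ _ _ (inner (const_tab hs a))).
- by move=> eta nu *; apply: strip_prod_const.
- exact: size_all2 io.
- exact: leqs_refl.
Qed.

End TableauSums.

(** * Linear and multilinear extensions *)

Section LinearExtension.
Variables (k : comNzRingType) (B : choiceType).
Implicit Types V W : lmodType k.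

Lemma lin_extEw V (f : B -> V) (d : {fset B}) x : (msupp x `<=` d)%fset ->
  lin_ext f x = \sum_(b <- d) x@_b *: f b.
Proof.
move=> le_xd; rewrite /lin_ext; apply/(big_fset_incl _ le_xd) => b _.
by move/mcoeff_outdom->; rewrite scale0r.
Qed.

Lemma lin_ext_linear V (f : B -> V) : linear (lin_ext f).
Proof.
move=> c x y; pose d := (msupp x `|` msupp y)%fset.
have le_d : (msupp (c *: x + y) `<=` d)%fset.
  apply: fsubset_trans (msuppD_le _ _) _; apply: fsetSU; exact: msuppZ_le.
rewrite (lin_extEw _ le_d) (@lin_extEw _ _ d x) ?fsubsetUl //.
rewrite (@lin_extEw _ _ d y) ?fsubsetUr // scaler_sumr -big_split /=.
by apply: eq_bigr => b _; rewrite mcoeffD mcoeffZ scalerDl scalerA.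
Qed.

Lemma lin_extD V (f : B -> V) x y :
  lin_ext f (x + y) = lin_ext f x + lin_ext f y.
Proof. by have := lin_ext_linear f 1 x y; rewrite !scale1r. Qed.

Lemma lin_extZ V (f : B -> V) c x : lin_ext f (c *: x) = c *: lin_ext f x.
Proof.
have f0 : lin_ext f 0 = 0 by rewrite /lin_ext msupp0 big_seq_fset0.
by have := lin_ext_linear f c x 0; rewrite f0 !addr0.
Qed.

Lemma lin_extB V (f : B -> V) x y :
  lin_ext f (x - y) = lin_ext f x - lin_ext f y.
Proof. by rewrite -!scaleN1r lin_extD lin_extZ. Qed.

Lemma lin_extU V (f : B -> V) b : lin_ext f << b >> = f b.
Proof. by rewrite /lin_ext msuppU oner_eq0 big_seq_fset1 mcoeffUU scale1r. Qed.

Lemma linear_sumZ V W (F : V -> W) (I : Type) (r : seq I) (c : I -> k) (v : I -> V) :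
  linear F -> F (\sum_(i <- r) c i *: v i) = \sum_(i <- r) c i *: F (v i).
Proof.
move=> linF; elim: r => [|i r IH]; last by rewrite !big_cons linF IH.
by rewrite !big_nil; have := linF (-1) 0 0; rewrite scaler0 addr0 scaleN1r addNr.
Qed.

Lemma linear_lin_ext V W (F : V -> W) (f : B -> V) x : linear F ->
  F (lin_ext f x) = lin_ext (F \o f) x.
Proof. exact: linear_sumZ. Qed.

Lemma malg_lin_ext (x : {malg k[B]}) : x = lin_ext (fun b => << b >>) x.
Proof.
rewrite {1}[x]monalgE /lin_ext; apply: eq_bigr => b _; apply/malgP => b'.
by rewrite mcoeffZ !mcoeffU mulr_natr.
Qed.

Lemma lin_ext_eq W (F : {malg k[B]} -> W) x : linear F ->
  lin_ext (fun b => F << b >>) x = F x.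
Proof. by move=> linF; rewrite {2}[x]malg_lin_ext linear_lin_ext. Qed.

End LinearExtension.

Section Multilinear.
Variables (k : comNzRingType) (A : choiceType).
Local Notation kA := {malg k[A]}.
Implicit Types V W : lmodType k.

Lemma linear_add (U V : lmodType k) (F G : U -> V) :
  linear F -> linear G -> linear (fun x => F x + G x).
Proof. by move=> lF lG c x y; rewrite lF lG scalerDr addrACA. Qed.

Lemma linear_zero (U V : lmodType k) : linear (fun _ : U => 0 : V).
Proof. by move=> c x y; rewrite scaler0 addr0. Qed.

Definition multilinear V (f : seq kA -> V) :=
  forall s1 s2, linear (fun x => f (s1 ++ x :: s2)).

Lemma multilinear_cons V (f : seq kA -> V) y :
  multilinear f -> multilinear (f \o cons y).
Proof. by move=> mf s1 s2; apply: (mf (y :: s1)). Qed.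

Section QuasiShuffle.
Variable diam : kA -> kA -> kA.
Hypotheses (diam_linl : forall y, linear (diam^~ y)).
Hypotheses (diam_linr : forall x, linear (diam x)).

Lemma insert_new_linear_fun V (g : kA -> seq kA -> V) x w :
  (forall w', linear (g^~ w')) -> linear (fun y => insert_new x (g y) w).
Proof.
elim: w g => [|z w IH] g lg /=; apply: linear_add; try exact: lg.
  exact: linear_zero.
by apply: (IH (fun y => g y \o cons z)) => w'; apply: lg.
Qed.

Lemma insert_merge_linear_fun V (g : kA -> seq kA -> V) x w :
  (forall w', linear (g^~ w')) -> linear (fun y => insert_merge diam x (g y) w).
Proof.
elim: w g => [|z w IH] g lg /=; first exact: linear_zero.
apply: linear_add; first exact: lg.
by apply: (IH (fun y => g y \o cons z)) => w'; apply: lg.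
Qed.

Lemma qshuffle_linear_fun V (g : kA -> seq kA -> V) t :
  (forall w, linear (g^~ w)) -> linear (fun y => qshuffle diam t (g y)).
Proof.
elim: t g => [|x t IH] g lg //=.
apply: (IH (fun y => qinsert diam x (g y))) => w; apply: linear_add.
  exact: insert_new_linear_fun.
exact: insert_merge_linear_fun.
Qed.

Lemma qinsert_linear V (f : seq kA -> V) w : multilinear f ->
  linear (fun x => qinsert diam x f w).
Proof.
move=> mf; apply: linear_add.
  elim: w f mf => [|z w IH] f mf /=; apply: linear_add; try exact: (mf [::]).
    exact: linear_zero.
  by apply: IH; apply: multilinear_cons.
elim: w f mf => [|z w IH] f mf /=; first exact: linear_zero.
apply: linear_add; last by apply: IH; apply: multilinear_cons.
by move=> c x y; rewrite diam_linl (mf [::]).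
Qed.

Lemma multilinear_qinsert V x (f : seq kA -> V) : multilinear f ->
  multilinear (qinsert diam x f).
Proof.
move=> mf s1 s2; apply: linear_add.
  elim: s1 f mf => [|z s1 IH] f mf /=; apply: linear_add.
  - exact: (mf [:: x]).
  - by apply: (insert_new_linear_fun (g := fun y => f \o cons y)) => w;
    apply: (mf [::]).
  - exact: (mf [:: x, z & s1]).
  - by apply: IH; apply: multilinear_cons.
elim: s1 f mf => [|z s1 IH] f mf /=; apply: linear_add.
- by move=> c y y'; rewrite diam_linr (mf [::]).
- by apply: (insert_merge_linear_fun (g := fun y => f \o cons y)) => w;
    apply: (mf [::]).
- exact: (mf (diam x z :: s1)).
- by apply: IH; apply: multilinear_cons.
Qed.

(** Needed because the powers of [a] are linear combinations of letters, whereas tableaux have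
    letters as entries. *)
Fixpoint mlin_ext V (G : seq A -> V) (xs : seq kA) : V :=
  if xs is x :: xs' then lin_ext (fun b => mlin_ext (G \o cons b) xs') x
  else G [::].

Lemma linear_mlin_ext V W (F : V -> W) G xs : linear F ->
  F (mlin_ext G xs) = mlin_ext (F \o G) xs.
Proof.
move=> linF; elim: xs G => //= x xs IH G; rewrite linear_lin_ext //.
by congr lin_ext; apply/funext => b /=; rewrite IH.
Qed.

Lemma mlin_ext_qshuffle V (f : seq kA -> V) xs : multilinear f ->
  mlin_ext (fun bs => qshuffle diam [seq << b >> | b <- bs] f) xs =
  qshuffle diam xs f.
Proof.
elim: xs f => //= x xs IH f mf.
rewrite -(lin_ext_eq (F := fun y => qshuffle diam xs (qinsert diam y f))).
  congr lin_ext; apply/funext => b; rewrite -IH //; exact: multilinear_qinsert.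
by apply: (qshuffle_linear_fun (g := fun y => qinsert diam y f)) => w;
  apply: qinsert_linear.
Qed.

End QuasiShuffle.

Lemma malg_scalerAr (M : monomType) c (g h : {malg k[M]}) :
  g * (c *: h) = c *: (g * h).
Proof.
apply/malgP => m; rewrite mcoeffZ.
rewrite (mcoeffMlw _ (fsubset_refl _) (msuppZ_le c h)) mcoeffMl mulr_sumr.
apply: eq_bigr => m1 _; rewrite mulr_sumr; apply: eq_bigr => m2 _.
by rewrite mcoeffZ mulrCA mulrnAr.
Qed.

Lemma multilinear_word_val : multilinear (@word_val k A).
Proof.
move=> s1 s2 c x y; rewrite /word_val !big_cat !big_cons /=.
by rewrite /letter lin_ext_linear mulrDl mulrDr -scalerAl malg_scalerAr.
Qed.

End Multilinear.

Lemma mlin_ext_prod (k : comNzRingType) (A : choiceType) (R : algType k)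
    (g : A -> R) xs :
  mlin_ext (fun bs => \prod_(b <- bs) g b) xs = \prod_(x <- xs) lin_ext g x.
Proof.
elim: xs => [|x xs IH] /=; first by rewrite !big_nil.
rewrite big_cons -IH; set P := mlin_ext _ _.
have mulP : linear (fun y : R => y * P).
  by move=> c y z; rewrite mulrDl -scalerAl.
rewrite [RHS](linear_lin_ext g x mulP); congr lin_ext; apply/funext => b /=.
have mulg : linear (fun y : R => g b * y).
  by move=> c y z; rewrite mulrDr -scalerAr.
rewrite [RHS](linear_mlin_ext _ xs mulg); congr mlin_ext; apply/funext => bs /=.
by rewrite big_cons.
Qed.

Lemma rmorph_malgZ (k : comNzRingType) (M : conomType) (Q : pzRingType)
    (f : {rmorphism {malg k[M]} -> Q}) c x : f (c *: x) = f c%:MP * f x.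
Proof. by rewrite -mul_malgC rmorphM. Qed.

(** [Q] is only a ring, so scalars pass through [f] as images of constants. *)
Lemma rmorph_mlin_ext (k : comNzRingType) (A : choiceType) (M : conomType)
    (Q : pzRingType) (f : {rmorphism {malg k[M]} -> Q})
    (G H : seq A -> {malg k[M]}) xs :
  (forall bs, f (G bs) = f (H bs)) -> f (mlin_ext G xs) = f (mlin_ext H xs).
Proof.
elim: xs G H => [|x xs IH] G H GH /=; first exact: GH.
rewrite /lin_ext !rmorph_sum; apply: eq_bigr => b _ /=.
by rewrite !rmorph_malgZ (IH _ (H \o cons b)) // => bs; apply: GH.
Qed.

(** * Membership of the constant tableau in the subalgebra *)

Section Generation.
Variables (k : comNzRingType) (A : choiceType).
Variable diam : {malg k[A]} -> {malg k[A]} -> {malg k[A]}.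
Hypothesis diamA : associative diam.
Hypotheses (diam_linl : forall y, linear (diam^~ y)).
Hypotheses (diam_linr : forall x, linear (diam x)).

Local Notation kA := {malg k[A]}.
Local Notation kYT := {malg k[{cmonom YT A}]}.
Local Notation Yd := (Y_diam diam).

Definition pi_diam : {rmorphism kYT -> Yd} :=
  Y_diam_pi diam \o Ypi k A.

Lemma pi_diamZ c (x : kYT) : pi_diam (c *: x) = Y_diam_scal diam c * pi_diam x.
Proof. exact: rmorph_malgZ. Qed.

Lemma pi_diamD (x y : kYT) : pi_diam (x + y) = pi_diam x + pi_diam y.
Proof. exact: rmorphD. Qed.

Lemma pi_diamB (x y : kYT) : pi_diam (x - y) = pi_diam x - pi_diam y.
Proof. exact: rmorphB. Qed.

Lemma pi_diam_SC (h : YT A) :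
  pi_diam (ptab k h) = pi_diam (\prod_(i <- SC h) ptab k i).
Proof.
congr (Y_diam_pi diam _); apply/rq_piP.
by apply: ideal_gen_in; exists h.
Qed.

Definition ptab_ext (x : {malg k[YT A]}) : kYT := lin_ext (@ptab k A) x.

Lemma pi_diam_ker x : lin_ext (Ltab diam) x = 0 -> pi_diam (ptab_ext x) = 0.
Proof.
move=> Lx; apply: etrans (rmorph0 (Y_diam_pi diam)); apply/rq_piP.
by rewrite subr0; apply: ideal_gen_in; exists x.
Qed.

(** A combination of tableaux representing a product of one-box tableaux with entries in [kA], in
    the form required by [L_diam_graph]. *)
Definition antidiag_ext (xs : seq kA) : {malg k[YT A]} :=
  mlin_ext (fun bs => << antidiag bs >>) xs.

Lemma pi_antidiag_ext xs :
  pi_diam (ptab_ext (antidiag_ext xs)) = \prod_(x <- xs) tab1 diam x.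
Proof.
rewrite /ptab_ext linear_mlin_ext; last exact: lin_ext_linear.
rewrite (rmorph_mlin_ext (f := pi_diam) _
  (H := fun bs => \prod_(b <- bs) ptab k (box1 b))).
  by rewrite mlin_ext_prod; apply: rmorph_prod.
move=> bs; apply: etrans (congr1 pi_diam (lin_extU _ _)) _.
by rewrite pi_diam_SC SC_antidiag big_map.
Qed.

Lemma Ltab_antidiag_ext xs :
  lin_ext (Ltab diam) (antidiag_ext xs) = qshuffle diam xs (@word_val k A).
Proof.
rewrite linear_mlin_ext; last exact: lin_ext_linear.
rewrite -mlin_ext_qshuffle //; last exact: multilinear_word_val.
by congr mlin_ext; apply/funext => bs; rewrite /= lin_extU Ltab_antidiag.
Qed.

Variable a : A.
Variable C : k -> Prop.
Hypotheses (C0 : C 0) (C1 : C 1) (CN1 : C (-1)).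

Local Notation subalg := (subalg_gen (Y_diam_scal diam) C (diam_gens diam a)).

(** Moves the problem to words: lifting a word combination to tableaux with class in the subalgebra
    suffices, without a quasi-shuffle ring structure on the target. *)
Definition generated (w : {malg k[{fmonom A}]}) : Prop :=
  exists2 x, lin_ext (Ltab diam) x = w & subalg (pi_diam (ptab_ext x)).

Lemma generatedD w w' : generated w -> generated w' -> generated (w + w').
Proof.
move=> [x <- gx] [y <- gy]; exists (x + y); first exact: lin_extD.
by rewrite /ptab_ext lin_extD pi_diamD; exact: subalg_gen_add gx gy.
Qed.

Lemma generatedZ c w : C c -> generated w -> generated (c *: w).
Proof.
move=> Cc [x <- gx]; exists (c *: x); first exact: lin_extZ.
rewrite /ptab_ext lin_extZ pi_diamZ; apply: subalg_gen_mul => //.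
exact: subalg_gen_scal.
Qed.

Lemma generated_qshuffle t :
  generated (qshuffle diam (map (dpowS diam a) t) (@word_val k A)).
Proof.
exists (antidiag_ext (map (dpowS diam a) t)); first exact: Ltab_antidiag_ext.
rewrite pi_antidiag_ext big_map; elim: t => [|l t IH].
  by rewrite big_nil -(rmorph1 (Y_diam_scal diam)); apply: subalg_gen_scal.
rewrite big_cons; apply: subalg_gen_mul IH; apply: subalg_gen_in.
by exists l.+1.
Qed.

Lemma generated0 : generated 0.
Proof. by have := generatedZ C0 (generated_qshuffle [::]); rewrite scale0r. Qed.

Variables (lam mu : seq nat) (hs : skew_shape lam mu).
Hypothesis C_fact : forall r, (r <= sumn lam - sumn mu)%N ->
  exists2 v, C v & r`!%:R * v = 1.

Lemma generated_const : generated (Ltab diam (const_tab hs a)).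
Proof.
rewrite Ltab_const //; elim/big_ind: _ => [||r _];
  [exact: generated0|exact: generatedD|].
have [v Cv rv] := C_fact (ltn_ord r : r <= _)%N.
set f := _ \o _; set nu := inner _.
have ol : outer (const_tab hs a) = lam.
  by case/and3P: (hs) => _ _; apply: outer_tabulate.
have eq_s : size nu = size lam.
  by rewrite -[in RHS]ol (size_all2 (inner_outer _)).
have snu : sorted geq nu by case/andP: (rowsP (const_tab hs a)).
(* Writing 1 as [v] times [r!] turns the sum into [v] times its symmetrization. *)
rewrite -[chainsum _ _ _ _ _]scale1r -rv mulrC -scalerA scaler_nat.
rewrite -chainsum_symsum //; apply: generatedZ => //.
apply: chainsum_closed => [||c sc]; [exact: generated0|exact: generatedD|].
apply: (@symsum_closed _ (fun l m => (l + m).+1) _ generated) => //.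
- exact: generated0.
- exact: generatedD.
- by move=> w gw; rewrite -scaleN1r; apply: generatedZ.
move=> t; rewrite -(qshuffle_map (op' := diam)); first exact: generated_qshuffle.
by move=> l m; apply: dpowS_add.
Qed.

(** The tableau and its lift [x] have the same linearization, so their difference dies in
    [Y_diam]. *)
Lemma const_subalg : subalg (tab diam (const_tab hs a)).
Proof.
have [x Lx gx] := generated_const.
suff -> : tab diam (const_tab hs a) = pi_diam (ptab_ext x) by [].
have /pi_diam_ker : lin_ext (Ltab diam) (<< const_tab hs a >> - x) = 0.
  by rewrite lin_extB lin_extU Lx subrr.
rewrite /ptab_ext lin_extB lin_extU pi_diamB => /eqP.
by rewrite subr_eq0 => /eqP.
Qed.

End Generation.

(** The falling factorial [n ^_ (n - r)] is the quotient of [n!] by [r!], so [r!] is invertible in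
    the image of [Z[1/n!]]. *)
Lemma inv_fact_dvd (k : comNzRingType) (u : k) r n : (r <= n)%N ->
  n`!%:R * u = 1 -> r`!%:R * ((n ^_ (n - r))%:R * u) = 1.
Proof.
move=> le_rn nu; rewrite mulrA -natrM mulnC -[RHS]nu; congr (_%:R * _).
by rewrite -(ffact_fact (leq_subr r n)) subKn.
Qed.

Theorem theorem3p16 (k : comNzRingType) (A : countType)
    (diam : {malg k[A]} -> {malg k[A]} -> {malg k[A]})
    (diamC : commutative diam) (diamA : associative diam)
    (diam_linl : forall y, linear (diam^~ y))
    (diam_linr : forall x, linear (diam x))
    (a : A) (lam mu : seq nat) (hs : skew_shape lam mu) (n : nat)
    (hn : n = (sumn lam - sumn mu)%N) :
  (forall u : k, n`!%:R * u = 1 ->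
     subalg_gen (Y_diam_scal diam) (Z_inv u) (diam_gens diam a)
       (tab diam (const_tab hs a))) /\
  (forall iota : {rmorphism rat -> k},
     subalg_gen (Y_diam_scal diam) (fun c => exists q : rat, c = iota q)
       (diam_gens diam a) (tab diam (const_tab hs a))).
Proof.
split=> [u nu|iota]; apply: const_subalg => //.
- by exists 0, 0%N; rewrite mul0r.
- by exists 1, 0%N; rewrite mulr1.
- by exists (-1), 0%N; rewrite mulr1 rmorphN.
- move=> r; rewrite -hn => le_rn; exists ((n ^_ (n - r))%:R * u).
    by exists (n ^_ (n - r))%:Z, 1%N.
  exact: inv_fact_dvd.
- by exists 0; rewrite rmorph0.
- by exists 1; rewrite rmorph1.
- by exists (-1); rewrite rmorphN rmorph1.
(* Over the rationals every factorial has an inverse, which [iota] carries to [k]. *)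
move=> r _; exists (iota r`!%:R^-1); first by exists r`!%:R^-1.
rewrite -(rmorph_nat iota) -rmorphM divff ?rmorph1 //.
by rewrite Num.Theory.pnatr_eq0 -lt0n fact_gt0.
Qed.
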